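(* Let $X$ be a regular topological space such that $\psi(x,X)>\omega$ for each $x\in X$. Let $X_\delta$ denote the $G_\delta$ modification of $X$. Then $X_\delta$ is an SHD, zero-dimensional, and Tychonoff space. Furthermore, if $X$ is also homogeneous, then $X_\delta$ is also homogeneous.
   Context: A topological space $X$ is selectively highly divergent (SHD) if for every sequence $(U_n)_{n\in\omega}$ of non-empty open subsets of $X$ one can choose points $x_n\in U_n$ such that the sequence $(x_n)$ has no convergent subsequence. Regular spaces are understood to be $T_1$. The pseudocharacter $\psi(x,X)$ of a point $x$ in a $T_1$ space $X$ is the least infinite cardinal $\kappa$ such that $\{x\}$ is the intersection of at most $\kappa$ open subsets of $X$; thus $\psi(x,X)>\omega$ means that $\{x\}$ is not a $G_\delta$ set. The $G_\delta$ modification $X_\delta$ is the set $X$ with the topology having as a base the family of all $G_\delta$ subsets of $X$. A space is zero-dimensional if it has a base of clopen sets. A space $X$ is homogeneous if for all $x,y\in X$ there is a homeomorphism $f:X\to X$ with $f(x)=y$. *)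

(* Defs.v *)
From HB Require Import structures.
From mathcomp Require Import all_boot all_order all_algebra.
From mathcomp Require Import all_classical all_reals all_analysis.
From mathcomp Require Import borel_hierarchy.

Set Implicit Arguments.
Unset Strict Implicit.
Unset Printing Implicit Defensive.

Import numFieldNormedType.Exports.

Local Open Scope classical_set_scope.

Section pseudocharacter.
Context {T : topologicalType}.
Implicit Types (K L : Type) (x : T).

(* Cardinals are represented by types, compared with [#<=]. *)
Definition is_bigcap_open K x :=
  exists F : set (set T),
    [/\ (F #<= [set: K])%card, F `<=` open & \bigcap_(U in F) U = [set x] ].

(* psi(x, T) > K. As psi(x, T) is the least infinite cardinal L such that
   [is_bigcap_open L x], it exceeds K iff every such L does; and K < L is
   stated as the negation of L <= K. *)
Definition pseudocharacter_gt K x :=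
  forall L, infinite_set [set: L] -> is_bigcap_open L x ->
    ~ ([set: L] #<= [set: K])%card.

Lemma pseudocharacter_gt_nat x :
  pseudocharacter_gt nat x <-> ~ Gdelta [set x].
Proof.
split=> [psix [F oF xF]|nG L _ [F [FL oF xF]] Lnat].
  apply: (psix nat) => //; first exact: infinite_nat.
  exists (range F); split; first exact: card_image_le.
    by move=> _ [n _ <-]; exact: oF.
  by rewrite xF bigcap_image.
apply: nG; have /countable_injP[f finj] := card_le_trans FL Lnat.
exists (fun n => \bigcap_(U in F `&` f @^-1` [set n]) U) => [n|].
  have [[U [FU fU]]|nU] := pselect (exists U, F U /\ f U = n); last first.
    rewrite (_ : _ `&` _ = set0) ?bigcap_set0; first exact: openT.
    by rewrite -subset0 => U FU; apply: nU; exists U.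
  rewrite (_ : _ `&` _ = [set U]) ?bigcap_set1; first exact: oF.
  rewrite eqEsubset; split=> [V [FV fV]|_ ->//].
  by apply: finj; rewrite ?inE//= fU.
rewrite -xF eqEsubset; split=> y Fy; first by move=> n _ U [FU _]; exact: Fy.
by move=> U FU; apply: (Fy (f U)).
Qed.

End pseudocharacter.

Lemma GdeltaI {T : topologicalType} (A B : set T) :
  Gdelta A -> Gdelta B -> Gdelta (A `&` B).
Proof.
move=> [F oF ->] [G oG ->]; exists (fun n => F n `&` G n).
  by move=> n; exact: openI.
by rewrite bigcapI.
Qed.

Definition Gdelta_modification (T : Type) : Type := T.

Section Gdelta_modification.
Variable T : topologicalType.
Local Notation Td := (Gdelta_modification T).

Let Gdelta_cover : \bigcup_(A in @Gdelta T) A = [set: Td].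
Proof.
by rewrite -subTset => x _; exists setT => //; exact/open_Gdelta/openT.
Qed.

Let Gdelta_join (A B : set T) (x : Td) : Gdelta A -> Gdelta B -> A x -> B x ->
  exists C : set T, [/\ Gdelta C, C x & C `<=` A `&` B].
Proof.
by move=> GA GB Ax Bx; exists (A `&` B); split => //; exact: GdeltaI.
Qed.

HB.instance Definition _ := Choice.on Td.
HB.instance Definition _ :=
  isBaseTopological.Build Td Gdelta_cover Gdelta_join.

End Gdelta_modification.

Definition selectively_highly_divergent (T : topologicalType) :=
  forall U : (set T)^nat, (forall n, open (U n) /\ U n !=set0) ->
  exists2 x : T^nat, (forall n, U n (x n)) &
    forall k : nat -> nat, {homo k : m n / (m < n)%N} ->
      ~ exists l : T, (x \o k) n @[n --> \oo] --> l.

(* The library's [zero_dimensional] only asks for distinct points to be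
   separated by a clopen set, which is weaker in general. *)
Definition clopen_based (T : topologicalType) :=
  exists2 B : set (set T), basis B & B `<=` clopen.

Definition tychonoff_space (T : topologicalType) :=
  @accessible_space T /\ completely_regular_space T.

(* [completely_regular_space] is phrased with uniformities; this is its
   formulation with real-valued functions. *)
Lemma tychonoff_spaceP (R : realType) (T : topologicalType) :
  tychonoff_space T <-> @accessible_space T /\
    forall (a : T) (B : set T), closed B -> ~ B a ->
    exists f : T -> R, [/\ continuous f, range f `<=` `[0%R, 1%R]%classic,
      f a = 0%R & forall b, B b -> f b = 1%R].
Proof.
split=> -[T1 sepT]; split=> // a B cB nBa.
  have /(uniform_separatorP (R := R))[f [cf f01 fa fB]] := sepT a B cB nBa.
  exists f; split=> //; first by apply: fa; exists a.
  by move=> b Bb; apply: fB; exists b.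
apply/(uniform_separatorP (R := R)).
have [f [cf f01 fa fB]] := sepT a B cB nBa.
by exists f; split=> // _ [b + <-]; [move=> ->|exact: fB].
Qed.

Definition homeomorphism (S T : topologicalType) (f : S -> T) :=
  continuous f /\
  exists g : T -> S, [/\ continuous g, cancel f g & cancel g f].

Definition homogeneous_space (T : topologicalType) :=
  forall x y : T, exists2 f : T -> T, homeomorphism f & f x = y.

(* Main.v *)
(** In a regular space every [Gdelta] set around [x] contains one of the form
    [\bigcap_n V n], where the [V n] are open neighbourhoods of [x] with
    [closure (V n.+1) `<=` V n]; such a set is also closed, hence clopen in
    the [Gdelta] modification.  When no point is a [Gdelta], the modification
    has no isolated points, so that one can pick the [x n] pairwise distinct.
    As complements of countable sets are [Gdelta], an injective sequence has
    no limit in the modification. *)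
Require Import Defs.
From mathcomp Require Import all_boot all_order all_algebra.
From mathcomp Require Import all_classical all_reals all_analysis.
From mathcomp Require Import borel_hierarchy.

Set Implicit Arguments.
Unset Strict Implicit.
Unset Printing Implicit Defensive.

Local Open Scope classical_set_scope.

(** The indicator function of a basic clopen set [U] with [a] in [U] and [U] disjoint from [C] is
    continuous and separates [a] from [C]. *)
Lemma clopen_based_completely_regular (T : topologicalType) :
  clopen_based T -> completely_regular_space T.
Proof.
move=> [B [_ Bnbhs] Bclopen] a C cC nCa.
have /Bnbhs[U [BU Ua] UC] : nbhs a (~` C).
  by apply: open_nbhs_nbhs; split=> //; rewrite openC.
have [oU cU] := Bclopen U BU.
pose f x := `[< U x >].
pose E := [set xy | f xy.1 = f xy.2].
(* The separating uniformity is pulled back along [f] from the discrete one on [bool]; [E] is the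
   preimage of the diagonal. *)
exists (Uniform.class (initial_topology f)), E; split.
- by exists [set xy | xy.1 = xy.2]; [move=> _ [z _ <-]|case].
- rewrite -subset0 => -[x y] [[/= -> Cy] fxy].
  have : `[< U y >] by rewrite -[X in is_true X]fxy; apply/asboolP.
  by move/asboolP/UC.
(* This uniformity is coarser than the topology of [T]: the preimage of [D] contains [U] or its
   complement, whichever holds [x], and both are open. *)
- move=> x V [W [[D oD <-] /= Dfx]] /filterS; apply.
  have [Ux|nUx] := pselect (U x).
    apply: (filterS (P := U)); last exact: open_nbhs_nbhs.
    by move=> y Uy; rewrite /= /f (asboolT Uy) -(asboolT Ux).
  apply: (filterS (P := ~` U)).
    by move=> y nUy; rewrite /= /f (asboolF nUy) -(asboolF nUx).
  by apply: open_nbhs_nbhs; split=> //; rewrite openC.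
Qed.

(** Points are removed one at a time: [U] minus a point stays open since points are closed, and
    nonempty since otherwise [U] would be an open singleton. *)
Lemma nonisolated_avoid_seq (T : topologicalType) :
  accessible_space T -> (forall x : T, ~ open [set x]) ->
  forall (U : set T) (s : seq T), open U -> U !=set0 ->
  exists2 x, U x & x \notin s.
Proof.
move=> T1 isoN U s; elim: s U => [|a s IHs] U oU U0.
  by have [x Ux] := U0; exists x.
have [||x [Ux /eqP xa] xs] := IHs (U `\ a).
- by apply: openI => //; rewrite openC; exact: accessible_closed_set1.
- apply: contrapT => /nonemptyPn/seteqP[Ua _].
  have Usub x : U x -> x = a.
    by move=> Ux; apply: contrapT => xa; apply: (Ua x).
  have [x Ux] := U0; apply: (isoN a); rewrite (_ : [set a] = U)//.
  by rewrite eqEsubset; split=> [_ ->|//]; rewrite -(Usub _ Ux).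
- by exists x => //; rewrite inE negb_or xa.
Qed.

Lemma injective_selection (T : choiceType) (U : (set T)^nat) :
  (forall n (s : seq T), exists2 x, U n x & x \notin s) ->
  exists2 x : T^nat, (forall n, U n (x n)) & injective x.
Proof.
move=> Us.
have /choice[f fP] : forall p : nat * seq T, exists x, U p.1 x /\ x \notin p.2.
  by move=> [n s]; have [x] := Us n s; exists x.
(* [s n] lists the [n] points chosen before stage [n], latest first, so that [x n] avoids all of
   them. *)
pose s := fix s n := if n is m.+1 then f (m, s m) :: s m else [::].
pose x n := f (n, s n).
have xs m n : (m < n)%N -> x m \in s n.
  elim: n => // n IHn; rewrite ltnS leq_eqVlt inE => /predU1P[->|/IHn ->].
    by rewrite eqxx.
  by rewrite orbT.
exists x => [n|m n xmn]; first by have [] := fP (n, s n).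
have xsN k : x k \notin s k by have [] := fP (k, s k).
case: (ltngtP m n) => // /xs; first by rewrite xmn (negPf (xsN n)).
by rewrite -xmn (negPf (xsN m)).
Qed.

Lemma continuous_preimage_Gdelta (S T : topologicalType) (f : S -> T)
    (A : set T) : continuous f -> Gdelta A -> Gdelta (f @^-1` A).
Proof.
move=> cf [F oF ->]; exists (fun n => f @^-1` F n); last first.
  by rewrite preimage_bigcap.
by move=> n; apply: open_comp => // x _; exact: cf.
Qed.

Lemma Gdelta_setC_countable (T : topologicalType) (A : set T) :
  accessible_space T -> countable A -> Gdelta (~` A).
Proof.
move=> T1 /pfcard_geP[->|[u]].
  by rewrite setC0; exact/open_Gdelta/openT.
exists (fun n => ~` [set u n]).
  by move=> n; rewrite openC; exact: accessible_closed_set1.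
rewrite -setC_bigcup; congr (~` _); rewrite bigcup_imset1.
by rewrite image_eq.
Qed.

Lemma regular_Gdelta_closed (T : topologicalType) (G : set T) (x : T) :
  @regular_space T -> Gdelta G -> G x ->
  exists H : set T, [/\ Gdelta H, closed H, H x & H `<=` G].
Proof.
move=> regT [F oF ->] Fx.
have shrink (V : set T) : open_nbhs x V ->
    exists2 W, open_nbhs x W & closure W `<=` V.
  move=> /open_nbhs_nbhs/regT[W]; rewrite nbhsE => -[V0 xV0 V0W] WV.
  by exists V0 => //; exact: subset_trans (closureS V0W) WV.
have /choice[f fP] : forall p : nat * set T, exists W, open_nbhs x p.2 ->
    open_nbhs x W /\ closure W `<=` p.2 `&` F p.1.
  (* [setT] is a dummy value, as the claim is vacuous when [V] is not an open neighbourhood of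
     [x]. *)
  move=> [n V]; have [xV|nxV] := pselect (open_nbhs x V); last by exists setT.
  have [|W xW WV] := shrink (V `&` F n); last by exists W.
  by apply: open_nbhsI => //; split=> //; exact: Fx.
(* The shift in the index matters: [V n.+1] lies in [F n], while [V 0] is unconstrained. *)
pose V := fix V n := if n is m.+1 then f (m, V m) else setT.
have xV n : open_nbhs x (V n).
  elim: n => [|n IHn]; first by split=> //; exact: openT.
  by have [] := fP (n, V n) IHn.
have VS n : closure (V n.+1) `<=` V n `&` F n.
  by have [] := fP (n, V n) (xV n).
exists (\bigcap_n V n); split.
- by exists V => // n; have [] := xV n.
- have -> : \bigcap_n V n = \bigcap_n closure (V n).
    rewrite eqEsubset; split=> y Vy n _; first exact/subset_closure/Vy.
    by have /VS[] := Vy n.+1 I.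
  by apply: closed_bigI => n _; exact: closed_closure.
- by move=> n _; have [] := xV n.
- by move=> y Vy n _; have /subset_closure/VS[] := Vy n.+1 I.
Qed.

Section Gdelta_modification_theory.
Variable T : topologicalType.
Local Notation Td := (Gdelta_modification T).

Lemma Gdelta_modification_open (G : set T) :
  Gdelta G -> open (G : set Td).
Proof.
by move=> GG; exists [set G]; rewrite ?bigcup_set1// => _ ->.
Qed.

Lemma nbhs_Gdelta_modificationP (x : Td) (A : set Td) :
  nbhs x A <-> exists G : set T, [/\ Gdelta G, G x & G `<=` A].
Proof.
rewrite nbhsE; split=> [[_ [[D DG <-] [G DGG Gx]] DA]|[G [GG Gx GA]]].
  by exists G; split=> // [|y Gy]; [exact: DG|apply: DA; exists G].
by exists G => //; split=> //; exact: Gdelta_modification_open.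
Qed.

Lemma Gdelta_modification_accessible :
  accessible_space T -> accessible_space Td.
Proof.
move=> T1 x y /T1[A [oA xA yA]]; exists A; split=> //.
exact/Gdelta_modification_open/open_Gdelta.
Qed.

Lemma Gdelta_modification_clopen_based :
  @regular_space T -> clopen_based Td.
Proof.
move=> regT; exists (@clopen Td) => //; split=> [A []//|x A].
move=> /nbhs_Gdelta_modificationP[G [GG Gx GA]].
have [H [GH cH Hx HG]] := regular_Gdelta_closed regT GG Gx.
exists H; last exact: subset_trans HG GA.
split=> //; split; first exact: Gdelta_modification_open.
(* The complement of [H] is open already in [T]. *)
by rewrite -openC; apply/Gdelta_modification_open/open_Gdelta; rewrite openC.
Qed.

Lemma Gdelta_modification_open_set1 (x : T) :
  open ([set x] : set Td) -> Gdelta [set x].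
Proof.
move=> ox; have /nbhs_Gdelta_modificationP : nbhs (x : Td) [set x].
  exact: open_nbhs_nbhs.
move=> [G [GG Gx Gsub]]; rewrite (_ : [set x] = G)//.
by rewrite eqEsubset; split=> // _ ->.
Qed.

Lemma Gdelta_modification_injective_not_cvg (y : Td^nat) (l : Td) :
  accessible_space T -> injective y -> ~ (y n @[n --> \oo] --> l).
Proof.
(* Removing [l] makes the complement of this countable set a neighbourhood of [l] even if [l] is a
   term of [y]; convergence then forces [y] to be eventually equal to [l]. *)
move=> T1 yinj; have cA : countable (range y `\ l).
  apply: card_le_trans (card_image_le y setT).
  exact: subset_card_le (@subDsetl _ _ _).
have lA : nbhs l (~` (range y `\ l)).
  apply/nbhs_Gdelta_modificationP; exists (~` (range y `\ l)); split=> //.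
    exact: Gdelta_setC_countable.
  by move=> [_]; exact.
move=> /(_ _ lA)[N _ yN].
have yl n : (N <= n)%N -> y n = l.
  by move=> /yN ynA; apply: contrapT => ynl; apply: ynA; split=> //; exists n.
by have /yinj/n_Sn : y N = y N.+1 by rewrite !yl.
Qed.

Lemma Gdelta_modification_shd :
  accessible_space T -> (forall x : T, ~ Gdelta [set x]) ->
  selectively_highly_divergent Td.
Proof.
move=> T1 GN U oU0; have [n s|x Ux xinj] := @injective_selection _ U.
  have [oU U0] := oU0 n; apply: nonisolated_avoid_seq => //.
    exact: Gdelta_modification_accessible.
  by move=> x /Gdelta_modification_open_set1; exact: GN.
exists x => // k kincr [l]; apply: Gdelta_modification_injective_not_cvg => //.
(* A subsequence of an injective sequence is injective, so the divergence of injective sequences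
   applies to it directly. *)
by apply: inj_comp => //; exact/incn_inj/leq_mono.
Qed.

End Gdelta_modification_theory.

(** Continuous preimages of [Gdelta] sets are [Gdelta]. Applied to a homeomorphism and its inverse,
    this transfers homogeneity. *)
Lemma Gdelta_modification_continuous (S T : topologicalType) (f : S -> T) :
  continuous f ->
  continuous (f : Gdelta_modification S -> Gdelta_modification T).
Proof.
move=> cf x A /nbhs_Gdelta_modificationP[G [GG Gfx GA]].
apply/nbhs_Gdelta_modificationP; exists (f @^-1` G); split=> //.
  exact: continuous_preimage_Gdelta.
by move=> y /GA.
Qed.

Lemma Gdelta_modification_homogeneous (T : topologicalType) :
  homogeneous_space T -> homogeneous_space (Gdelta_modification T).
Proof.
move=> homT x y; have [f [cf [g [cg fK gK]]] fxy] := homT x y.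
exists f => //; split; first exact: Gdelta_modification_continuous.
by exists g; split=> //; exact: Gdelta_modification_continuous.
Qed.

Theorem theorem5 (X : topologicalType)
    (X_T1 : @accessible_space X) (X_regular : @regular_space X)
    (X_psi : forall x : X, pseudocharacter_gt nat x) :
  [/\ selectively_highly_divergent (Gdelta_modification X),
      clopen_based (Gdelta_modification X),
      tychonoff_space (Gdelta_modification X) &
      homogeneous_space X -> homogeneous_space (Gdelta_modification X)].
Proof.
have clb := Gdelta_modification_clopen_based X_regular.
split=> //; last exact: Gdelta_modification_homogeneous.
- by apply: Gdelta_modification_shd => // x; exact/pseudocharacter_gt_nat.
- split; first exact: Gdelta_modification_accessible.
  exact: clopen_based_completely_regular.
Qed.
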